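(* Let $\Omega\subset\mathbb{R}^d$, $d\ge2$, be a bounded (polygonal) domain whose closure satisfies the uniformly positive reach condition. Let $\mathcal{L}(u)=\sum_{i,j=1}^d a^{ij}(x)\frac{\partial^2}{\partial x_i\partial x_j}u$ where $a^{ij}\in L^\infty(\Omega)$ satisfy: (symmetry) $a^{ij}=a^{ji}$ for all $i,j$; (ellipticity) there are $0<\lambda\le\Lambda$ with $\lambda\sum_i\eta_i^2\le\sum_{i,j}a^{ij}(x)\eta_i\eta_j\le\Lambda\sum_i\eta_i^2$ for all $\eta\in\mathbb{R}^d\setminus\{0\}$ and $x\in\Omega$; (Cordès condition) there is $\epsilon\in(0,1]$ with $$\frac{\sum_{i,j=1}^d(a^{ij})^2}{\left(\sum_{i=1}^da^{ii}\right)^2}\le\frac1{d-1+\epsilon}\quad\text{a.e. in }\Omega.$$ Assume $\epsilon>1-A^2$, where $A>0$ is a constant with $A\|v\|_{H^2}\le\|\Delta v\|_{L^2(\Omega)}$ for all $v\in H^2(\Omega)\cap H^1_0(\Omega)$. Let $u$ be the solution of $\mathcal{L}(u)=f$ in $\Omega$, $u=g$ on $\partial\Omega$, and let $u_s$ be the corresponding spline collocation minimizer with residual $\epsilon_1$, as defined in the context. Suppose that $u\in H^3(\Omega)$ and $u-u_s=0$ on $\partial\Omega$. Then $$\|u-u_s\|_{L^2(\Omega)}\le C\epsilon_1,\qquad\|\nabla(u-u_s)\|_{L^2(\Omega)}\le C\epsilon_1,\qquad|u-u_s|_{H^2}\le C\epsilon_1$$ for a positive constant $C$ depending on $\Omega$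 and $A_1$, where $A_1>0$ is a constant such that $A_1\|v\|_{H^2}\le\|\mathcal{L}v\|_{L^2(\Omega)}$ for all $v\in H^2(\Omega)\cap H^1_0(\Omega)$.
   Context: Norms: $|v|_{H^2}=\sum_{i,j=1}^d\|\frac{\partial^2 v}{\partial x_i\partial x_j}\|_{L^2(\Omega)}$ and $\|v\|_{H^2}=\|v\|_{L^2(\Omega)}+\|\nabla v\|_{L^2(\Omega)}+|v|_{H^2}$. Reach: for non-empty $K\subseteq\mathbb{R}^d$, $r_K$ is the supremum of the $r$ such that every point of $\{x:\mathrm{dist}(x,K)<r\}$ has a unique projection in $K$; $K$ has positive reach if $r_K>0$. With $B(0,\epsilon)$ the closed ball, $E_\epsilon(K)=(K^c+B(0,\epsilon))^c$ for $\epsilon>0$, $E_0(K)=K$; $K$ has uniformly positive reach $r_0>0$ if for some $\epsilon_0>0$ every $E_\epsilon(K)$, $\epsilon\in[0,\epsilon_0]$, has positive reach at least $r_0$. Splines: $\triangle$ is a triangulation (tetrahedralization if $d=3$) of $\Omega$. $S_D^{-1}(\triangle)$ is the space of (discontinuous) piecewise polynomials of degree $D$ over $\triangle$; each $s$ in it is identified with its vector $\mathbf{c}$ of Bernstein–Bézier coefficients. $S^r_D(\triangle)=C^r(\Omega)\cap S^{-1}_D(\triangle)$, $r\ge2$, $D$ large enough ($D\ge3r+2$ if $d=2$, $D\ge6r+3$ if $d=3$). The domain points of degree $D'$ of a simplex $\langle v_1,\dots,v_{d+1}\rangle$ are $\frac{1}{D'}\sum_ki_kv_k$ with integers $i_k\ge0$,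 $\sum_ki_k=D'$; fix $D'>D$. Collocation: $\mathcal{K}\mathbf{c}$ is the vector of values of $\mathcal{L}s$ at the domain points of degree $D'$ of $\triangle$, $\mathbf{f}$ the vector of values of $f$ there; $B\mathbf{c}$ and $\mathbf{g}$ are the vectors of values of $s$ and $g$ at the domain points on $\partial\Omega$; $H\mathbf{c}=0$ and $H_0\mathbf{c}=0$ are the $C^r$ and $C^0$ smoothness conditions across interior faces. With fixed $\alpha,\beta,\gamma>0$, $u_s\in S_D^r(\triangle)$ is the spline whose coefficient vector minimizes $$\tfrac12\left(\alpha\|B\mathbf{c}-\mathbf{g}\|^2+\beta\|H\mathbf{c}\|^2+\gamma\|H_0\mathbf{c}\|^2\right)\quad\text{subject to }\mathcal{K}\mathbf{c}=\mathbf{f},$$ the constraint being satisfied up to the residual $\epsilon_1=\|\mathcal{K}\mathbf{c}-\mathbf{f}\|$ (a nearby minimization problem). As a standing property, $\|\mathcal{L}u_s-f\|_{L^2(\Omega)}\le\epsilon_1$. *)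

(* Defs.v *)
From HB Require Import structures.
From mathcomp Require Import all_boot all_order all_algebra.
From mathcomp Require Import all_classical all_reals all_analysis.

Set Implicit Arguments.
Unset Strict Implicit.
Unset Printing Implicit Defensive.
Import Order.TTheory GRing.Theory Num.Theory.
Import numFieldNormedType.Exports.
Local Open Scope classical_set_scope.
Local Open Scope ring_scope.

(* 'rV[R]_n carries the product sigma-algebra, generated by the coordinates
   (the Borel sigma-algebra of R^n). *)
Definition rV_display : measure_display.
Proof. exact: default_measure_display. Qed.

Section rV_measurable.
Context (R : realType) (n : nat).

Let coord (i : 'I_n) (x : 'rV[R]_n) : measurableTypeR R := x 0 i.

Let rV_set0 : g_sigma_preimage coord set0.
Proof. exact: sigma_algebra0. Qed.

Let rV_setC A : g_sigma_preimage coord A -> g_sigma_preimage coord (~` A).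
Proof. exact: sigma_algebraC. Qed.

Let rV_bigcup (F : _^nat) : (forall i, g_sigma_preimage coord (F i)) ->
  g_sigma_preimage coord (\bigcup_i (F i)).
Proof. exact: sigma_algebra_bigcup. Qed.

HB.instance Definition _ := @isMeasurable.Build rV_display
  'rV[R]_n (g_sigma_preimage coord) rV_set0 rV_setC rV_bigcup.

Lemma measurable_coord (i : 'I_n) :
  measurable_fun [set: 'rV[R]_n] (fun x : 'rV[R]_n => x 0 i : R).
Proof.
move=> _ Y mY; rewrite setTI; apply: sub_sigma_algebra => /=.
rewrite -bigcup_seq/=; exists i => /=; first by rewrite mem_index_enum.
by exists Y => //; rewrite setTI.
Qed.

Lemma measurable_fun_coordP d (T : measurableType d) (f : T -> 'rV[R]_n) :
  (forall i, measurable_fun [set: T] (fun t => f t 0 i : R)) ->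
  measurable_fun [set: T] f.
Proof.
move=> mf.
suff H : g_sigma_preimage coord `<=` [set B | measurable (f @^-1` B)].
  by move=> _ B mB; rewrite setTI; apply: H.
apply: smallest_sub.
  split => /=.
  - by rewrite preimage_set0.
  - by move=> A mA; rewrite setTD preimage_setC; exact: measurableC.
  - by move=> F mF; rewrite preimage_bigcup; exact: bigcup_measurable.
rewrite -bigcup_seq => B [i _ [A mA <-]] /=.
by rewrite setTI -[X in measurable X]setTI; exact: (mf i).
Qed.

End rV_measurable.

Definition rV_cons (R : realType) n (p : R * 'rV[R]_n) : 'rV[R]_n.+1 :=
  \row_j if unlift ord0 j is Some k then p.2 0 k else p.1.

Lemma measurable_rV_cons (R : realType) n :
  measurable_fun [set: measurableTypeR R * 'rV[R]_n]
    (@rV_cons R n : measurableTypeR R * 'rV[R]_n -> 'rV[R]_n.+1).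
Proof.
apply: measurable_fun_coordP => i; rewrite /rV_cons.
case: (unliftP ord0 i) => [j ->|->].
  rewrite (_ : (fun _ => _) = (fun p : R * 'rV[R]_n => p.2 0 j)); last first.
    by apply/funext => p; rewrite mxE liftK.
  exact: (measurableT_comp (measurable_coord j) measurable_snd).
rewrite (_ : (fun _ => _) = fst); first exact: measurable_fst.
by apply/funext => p; rewrite mxE unlift_none.
Qed.

(* mu |-> (one-dimensional Lebesgue measure) x mu, transported to row vectors *)
Definition lebesgue_cons (R : realType) n (mu : set 'rV[R]_n -> \bar R) :
    set 'rV[R]_n.+1 -> \bar R :=
  pushforward (@lebesgue_measure R \x mu)%E (@rV_cons R n).

Section lebesgue_cons_measure.
Local Open Scope ereal_scope.
Context (R : realType) (n : nat).
Variable mu : {sigma_finite_measure set 'rV[R]_n -> \bar R}.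

Let mcons := @measurable_rV_cons R n.

Let cons0 : lebesgue_cons mu set0 = 0.
Proof. by rewrite /lebesgue_cons /pushforward preimage_set0 measure0. Qed.

Let cons_ge0 A : 0 <= lebesgue_cons mu A.
Proof. exact: measure_ge0. Qed.

Let cons_sigma_additive : semi_sigma_additive (lebesgue_cons mu).
Proof.
move=> F mF tF mUF; rewrite /lebesgue_cons /pushforward preimage_bigcup.
apply: measure_semi_sigma_additive.
- by move=> k; rewrite -[X in measurable X]setTI; exact: mcons.
- apply/trivIsetP => /= i j _ _ ij; rewrite -preimage_setI.
  by move/trivIsetP : tF => /(_ _ _ _ _ ij) ->//; rewrite preimage_set0.
- by rewrite -preimage_bigcup -[X in measurable X]setTI; exact: mcons.
Qed.

HB.instance Definition _ := isMeasure.Build _ _ _ (lebesgue_cons mu)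
  cons0 cons_ge0 cons_sigma_additive.

Let cons_sigma_finite : sigma_finite [set: 'rV[R]_n.+1] (lebesgue_cons mu).
Proof.
have /sigma_finiteP[F [FT ndF mF]] : sigma_finite setT mu by exact: sigma_finiteT.
pose tl (x : 'rV[R]_n.+1) : 'rV[R]_n := \row_j x ord0 (lift ord0 j).
have tlK (x : 'rV[R]_n.+1) : rV_cons (x ord0 ord0, tl x) = x.
  apply/rowP => j; rewrite mxE; case: (unliftP ord0 j) => [k ->|->//].
  by rewrite /= mxE.
have cons_hd p : (@rV_cons R n p) ord0 ord0 = p.1.
  by rewrite mxE unlift_none.
have cons_tl p : tl (@rV_cons R n p) = p.2.
  by apply/rowP => j; rewrite !mxE liftK.
have mtl : measurable_fun setT tl.
  apply: measurable_fun_coordP => i.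
  rewrite (_ : (fun _ => _) = (fun x : 'rV[R]_n.+1 => x ord0 (lift ord0 i))).
    exact: measurable_coord.
  by apply/funext => x; rewrite mxE.
pose hd (x : 'rV[R]_n.+1) : R := x ord0 ord0.
exists (fun k => hd @^-1` `[(- k%:R)%R, k%:R%R]%classic `&` tl @^-1` F k).
  apply/seteqP; split => // x _.
  have : [set: 'rV[R]_n] (tl x) by [].
  rewrite FT => -[k _ Fk].
  pose m := maxn k (Num.truncn `|hd x|).+1.
  exists m => //; split.
    rewrite /preimage /= in_itv /= -ler_norml.
    apply: (@le_trans _ _ (Num.truncn `|hd x|).+1%:R)%R.
      exact/ltW/truncnS_gt.
    by rewrite ler_nat leq_maxr.
  by have /subsetPset := ndF _ _ (leq_maxl k (Num.truncn `|hd x|).+1); exact.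
move=> k; split.
  apply: measurableI => /=.
    rewrite -[X in measurable X]setTI.
    exact: (@measurable_coord R n.+1 ord0 measurableT _ (measurable_itv _)).
  by rewrite -[X in measurable X]setTI; apply: mtl => //; exact: (mF k).1.
rewrite /lebesgue_cons /pushforward.
rewrite (_ : _ @^-1` _ = `[(- k%:R)%R, k%:R%R]%classic `*` F k); last first.
  by apply/seteqP; split => -[x y] /=; rewrite /hd cons_hd cons_tl.
rewrite product_measure1E//; last exact: (mF k).1.
apply: lte_mul_pinfty => //; last exact: (mF k).2.
by rewrite /= lebesgue_measure_itv; case: ifP.
Qed.

HB.instance Definition _ := Measure_isSigmaFinite.Build _ _ _
  (lebesgue_cons mu) cons_sigma_finite.

End lebesgue_cons_measure.

Fixpoint lebesgue_rV (R : realType) (n : nat) :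
    {sigma_finite_measure set 'rV[R]_n -> \bar R} :=
  match n with
  | 0 => \d_(0 : 'rV[R]_0)
  | n'.+1 => lebesgue_cons (lebesgue_rV R n')
  end.

Section euclidean.
Context (R : realType) (d : nat).
Implicit Types (x : 'rV[R]_d) (K : set 'rV[R]_d).

(* The library norm on 'rV[R]_d is the sup norm; projections and reach need
   the Euclidean one. *)
Definition enorm x : R := Num.sqrt (\sum_i (x 0 i) ^+ 2).

Definition edist_to K x : \bar R := ereal_inf [set (enorm (x - y))%:E | y in K].

Definition is_projection K x y := K y /\ (enorm (x - y))%:E = edist_to K x.

Definition reach K : \bar R :=
  ereal_sup [set r%:E | r in [set r : R |
    forall x, (edist_to K x < r%:E)%E -> exists! y, is_projection K x y]].

(* E_eps(K) = (K^c + B(0, eps))^c; at eps = 0 this is K itself. *)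
Definition erosion (eps : R) K : set 'rV[R]_d :=
  ~` [set x + y | x in ~` K & y in [set y | enorm y <= eps]].

(* The reach is only defined for non-empty sets, whence the first conjunct. *)
Definition uniformly_positive_reach K :=
  exists2 r0 : R, 0 < r0 & exists2 eps0 : R, 0 < eps0 &
    forall eps, 0 <= eps <= eps0 ->
      erosion eps K !=set0 /\ (r0%:E <= reach (erosion eps K))%E.

Definition boundary (Omega : set 'rV[R]_d) := closure Omega `\` interior Omega.

End euclidean.

Section sobolev.
Context (R : realType) (d : nat).
Local Notation E := 'rV[R]_d.
Local Notation leb := (lebesgue_rV R d).
Implicit Types (Omega : set E) (f g h s phi : E -> R) (i j : 'I_d).

Definition unitv i : E := delta_mx 0 i.

Fixpoint Ck Omega (k : nat) f : Prop :=
  (forall x, Omega x -> {for x, continuous f}) /\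
  match k with
  | 0 => True
  | k'.+1 => forall i, (forall x, Omega x -> derivable f x (unitv i)) /\
                       Ck Omega k' (fun x => 'D_(unitv i) f x)
  end.

Definition test_function Omega phi :=
  [/\ forall k, Ck setT k phi,
      compact (closure [set x | phi x != 0]) &
      closure [set x | phi x != 0] `<=` Omega].

Definition Lpnorm Omega (p : \bar R) f : \bar R :=
  'N[leb]_p [ EFin \o (f \_ Omega) ].

Definition L2norm Omega f : \bar R := Lpnorm Omega 2%:E f.

Definition in_Lp Omega (p : \bar R) f :=
  measurable_fun Omega f /\ (Lpnorm Omega p f < +oo)%E.

Definition weak_partial Omega i f h := forall phi, test_function Omega phi ->
  (\int[leb]_(x in Omega) (f x * 'D_(unitv i) phi x)%:E =
   - \int[leb]_(x in Omega) (h x * phi x)%:E)%E.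

(* A Sobolev function is handled together with representatives of its (almost
   everywhere unique) weak derivatives. *)
Record jet := Jet {
  jfun : E -> R;
  jgrad : 'I_d -> E -> R;
  jhess : 'I_d -> 'I_d -> E -> R }.

Definition jet_sub (u v : jet) : jet :=
  Jet (fun x => jfun u x - jfun v x)
      (fun i x => jgrad u i x - jgrad v i x)
      (fun i j x => jhess u i j x - jhess v i j x).

Definition classical_jet s : jet :=
  Jet s (fun i x => 'D_(unitv i) s x)
        (fun i j x => 'D_(unitv i) (fun y => 'D_(unitv j) s y) x).

Implicit Types u v : jet.

Definition in_H1 Omega v :=
  in_Lp Omega 2%:E (jfun v) /\
  forall i, in_Lp Omega 2%:E (jgrad v i) /\
            weak_partial Omega i (jfun v) (jgrad v i).

Definition in_H2 Omega v :=
  in_H1 Omega v /\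
  forall i j, in_Lp Omega 2%:E (jhess v i j) /\
              weak_partial Omega i (jgrad v j) (jhess v i j).

Definition in_H3 Omega v :=
  in_H2 Omega v /\
  forall i j k, exists2 h, in_Lp Omega 2%:E h &
                           weak_partial Omega k (jhess v i j) h.

(* H^1_0 is the H^1-closure of the test functions. *)
Definition in_H10 Omega v :=
  in_H1 Omega v /\
  exists phi : nat -> E -> R,
    [/\ forall n, test_function Omega (phi n),
        L2norm Omega (fun x => jfun v x - phi n x) @[n --> \oo] --> 0%E &
        forall i, L2norm Omega (fun x => jgrad v i x - 'D_(unitv i) (phi n) x)
                    @[n --> \oo] --> 0%E].

(* v = g on the boundary of Omega, for boundary data g with pointwise values:
   v - G is in H^1_0 for an extension G of g that is in H^1 and continuous on
   the closure. *)
Definition boundary_value Omega v g :=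
  exists G : jet,
    [/\ in_H1 Omega G, {within closure Omega, continuous (jfun G)},
        forall x, boundary Omega x -> jfun G x = g x &
        in_H10 Omega (jet_sub v G)].

Definition grad_L2norm Omega v : \bar R :=
  L2norm Omega (fun x => Num.sqrt (\sum_i (jgrad v i x) ^+ 2)).

Definition H2seminorm Omega v : \bar R :=
  (\sum_i \sum_j L2norm Omega (jhess v i j))%E.

Definition H2norm Omega v : \bar R :=
  (L2norm Omega (jfun v) + grad_L2norm Omega v + H2seminorm Omega v)%E.

Definition laplacian v : E -> R := fun x => \sum_i jhess v i i x.

Definition coefficients := 'I_d -> 'I_d -> E -> R.

Implicit Type a : coefficients.

Definition Lop a v : E -> R := fun x => \sum_i \sum_j a i j x * jhess v i j x.

Definition elliptic Omega a (lam Lam : R) :=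
  forall (eta : E) (x : E), eta != 0 -> Omega x ->
    lam * (\sum_i (eta 0 i) ^+ 2)
      <= \sum_i \sum_j a i j x * eta 0 i * eta 0 j
      <= Lam * (\sum_i (eta 0 i) ^+ 2).

Definition cordes Omega a (eps : R) :=
  {ae leb, forall x, Omega x ->
    (\sum_i \sum_j (a i j x) ^+ 2) / (\sum_i a i i x) ^+ 2
      <= 1 / (d%:R - 1 + eps)}.

Definition H2_coercive Omega (P : jet -> E -> R) (c : R) :=
  forall v, in_H2 Omega v -> in_H10 Omega v ->
    (c%:E * H2norm Omega v <= L2norm Omega (P v))%E.

End sobolev.

Section splines.
Context (R : realType) (d : nat).
Local Notation E := 'rV[R]_d.

Definition simplex_vertices := 'I_d.+1 -> E.

Implicit Type v : simplex_vertices.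

(* rows (1, v_k): invertible iff the vertices are affinely independent *)
Definition vertex_mx v : 'M[R]_(1 + d) :=
  \matrix_(k < 1 + d) (row_mx 1%:M (v k) : 'rV[R]_(1 + d)).

(* Barycentric coordinates: the solution b of b * vertex_mx v = (1, x), i.e.
   \sum_k b_k = 1 and \sum_k b_k v_k = x. *)
Definition bary v (x : E) (k : 'I_d.+1) : R :=
  (row_mx 1%:M x *m invmx (vertex_mx v)) 0 k.

Definition face v (S : {set 'I_d.+1}) : set E :=
  [set x | forall k, 0 <= bary v x k /\ (k \notin S -> bary v x k = 0)].

Definition simplex v : set E := face v [set: 'I_d.+1].

Definition mindex (D : nat) : Type :=
  {i : {ffun 'I_d.+1 -> 'I_D.+1} | \sum_k (i k : nat) == D}.
HB.instance Definition _ D := Finite.on (mindex D).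

Definition bernstein v D (i : mindex D) (x : E) : R :=
  (D`!)%:R / (\prod_k ((val i k)`!)%:R) * \prod_k bary v x k ^+ (val i k).

Definition domain_point v D (i : mindex D) : E :=
  D%:R^-1 *: \sum_k (val i k)%:R *: v k.

Variable N : nat.
Implicit Types (T : 'I_N -> simplex_vertices) (t : 'I_N).

(* the vertices of T t (by position) shared with T t' *)
Definition common T t t' : {set 'I_d.+1} :=
  [set k | [exists k', T t k == T t' k']].

Definition triangulation (Omega : set E) T :=
  [/\ forall t, vertex_mx (T t) \in unitmx,
      Omega = interior (\bigcup_t simplex (T t)) &
      forall t t', t != t' -> common T t t' != [set: 'I_d.+1]%SET /\
        simplex (T t) `&` simplex (T t') = face (T t) (common T t t')].

(* A spline in S_D^{-1} is given by its Bernstein-Bezier coefficients, indexed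
   by (simplex, multi-index). *)
Definition ncoef D := #|{: 'I_N * mindex D}|.

Definition piece T D (c : 'cV[R]_(ncoef D)) t (x : E) : R :=
  \sum_(i : mindex D) c (enum_rank (t, i)) 0 * bernstein (T t) i x.

(* s is in S_D^r, with coefficient vector c *)
Definition is_spline (Omega : set E) T r D (c : 'cV[R]_(ncoef D)) (s : E -> R) :=
  Ck Omega r s /\
  forall t x, interior (simplex (T t)) x -> s x = piece T c t x.

Definition iter_partial (w : seq 'I_d) (f : E -> R) : E -> R :=
  foldr (fun i g x => 'D_(unitv R i) g x) f w.

(* C^r smoothness conditions across interior faces, i.e. the facets shared by
   two simplices *)
Definition smooth_across T r D (c : 'cV[R]_(ncoef D)) :=
  forall t t', t != t' -> #|common T t t'| = d ->
    forall (w : seq 'I_d) (x : E), (size w <= r)%N ->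
      face (T t) (common T t t') x ->
      iter_partial w (piece T c t) x = iter_partial w (piece T c t') x.

(* Vectors of values at domain points are indexed by (simplex, multi-index),
   the value at a point shared by several simplices being taken in each. *)
Definition sample_pt T D' (p : 'I_N * mindex D') : E :=
  domain_point (T p.1) p.2.

Definition sample T D' (f : E -> R) (p : 'I_N * mindex D') : R :=
  f (sample_pt T p).

Definition collocation (a : coefficients R d) T D D' (c : 'cV[R]_(ncoef D))
    (p : 'I_N * mindex D') : R :=
  Lop a (classical_jet (piece T c p.1)) (sample_pt T p).

Definition residual (a : coefficients R d) (f : E -> R) T D D'
    (c : 'cV[R]_(ncoef D)) : R :=
  Num.sqrt (\sum_(p : 'I_N * mindex D')
    (collocation a T c p - sample T f p) ^+ 2).

Definition boundary_misfit2 (Omega : set E) (g : E -> R) T D D'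
    (c : 'cV[R]_(ncoef D)) : R :=
  \sum_(p : 'I_N * mindex D' | sample_pt T p \in boundary Omega)
    (piece T c p.1 (sample_pt T p) - sample T g p) ^+ 2.

Definition sqnorm m (y : 'cV[R]_m) : R := \sum_k (y k 0) ^+ 2.

Definition objective (Omega : set E) (g : E -> R) T D D' (alpha beta gam : R)
    mH (H : 'M[R]_(mH, ncoef D)) m0 (H0 : 'M[R]_(m0, ncoef D))
    (c : 'cV[R]_(ncoef D)) : R :=
  2^-1 * (alpha * boundary_misfit2 Omega g T D' c
          + beta * sqnorm (H *m c) + gam * sqnorm (H0 *m c)).

(* c minimizes the objective subject to K c = f up to the tolerance eps1, and
   its own residual is eps1. *)
Definition collocation_minimizer (Omega : set E) (a : coefficients R d)
    (f g : E -> R) T D D' (alpha beta gam : R)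
    mH (H : 'M[R]_(mH, ncoef D)) m0 (H0 : 'M[R]_(m0, ncoef D))
    (c : 'cV[R]_(ncoef D)) (eps1 : R) :=
  residual a f T D' c = eps1 /\
  forall c' : 'cV[R]_(ncoef D), residual a f T D' c' <= eps1 ->
    objective Omega g T D' alpha beta gam H H0 c
      <= objective Omega g T D' alpha beta gam H H0 c'.

End splines.

Definition polygonal (R : realType) d (Omega : set 'rV[R]_d) :=
  exists N (T : 'I_N -> simplex_vertices R d), triangulation Omega T.

(* Main.v *)
(* With v = u - us, the coercivity of L gives
   A1 |v|_{H^2} <= |L v| = |f - L us| <= eps1, so C = 1 / A1 works as soon as v
   is known to be in H^2.  The spline us is only C^2 inside Omega; its second
   derivatives are bounded because they are polynomial on the interiors of
   finitely many simplices, whose union is dense in Omega, and they are weak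
   derivatives by integration by parts against a test function.
   Coercivity of L comes from that of the Laplacian: with t = tr a,
   S = sum (a^ij)^2 and c = t / S, the Cordes condition says that the Frobenius
   norm of I - c a is at most sqrt (1 - eps) < A, so c L is a small
   perturbation of the Laplacian. *)
Require Import Defs.
From mathcomp Require Import all_boot all_order all_algebra.
From mathcomp Require Import all_classical all_reals all_analysis.
From mathcomp Require Import measurable_realfun ring lra.
Import Order.TTheory GRing.Theory Num.Theory.
Import numFieldNormedType.Exports.
Local Open Scope classical_set_scope.
Local Open Scope ring_scope.

(** * Lebesgue measure on row vectors *)

(** The sigma-algebra is generated by the coordinates, so openness is reduced to coordinate
    conditions: [U] is the union of the rational boxes it contains, and there are only countably
    many of them. *)
Lemma open_measurable_rV (R : realType) (n : nat) (U : set 'rV[R]_n) :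
  open U -> measurable U.
Proof.
move=> oU.
pose box (p : 'rV[rat]_n * nat) : set 'rV[R]_n :=
  [set y | forall i, `|y 0 i - ratr (p.1 0 i)| < p.2.+1%:R^-1].
have mbox p : measurable (box p).
  rewrite (_ : box p = \bigcap_(i in [set: 'I_n])
    ((fun y : 'rV[R]_n => y 0 i) @^-1`
       [set t : measurableTypeR R | `|t - ratr (p.1 0 i)| < p.2.+1%:R^-1])); last first.
    by apply/seteqP; split=> [y yp i _|y yp i]; [exact: yp|exact: (yp i)].
  apply: fin_bigcap_measurable; first exact: finite_finset.
  move=> i _; rewrite -[X in measurable X]setTI; apply: measurable_coord => //.
  apply: open_measurable.
  rewrite (_ : [set t | _] = ball (ratr (p.1 0 i) : R) p.2.+1%:R^-1); last first.
    by apply/seteqP; split=> t; rewrite /ball/= distrC.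
  exact: ball_open.
rewrite (_ : U = \bigcup_p (if `[< box p `<=` U >] then box p else set0)); last first.
  apply/seteqP; split => [x Ux|x [p _]]; last by case: asboolP => // + ?; apply.
  have /nbhs_ballP[r /= r0 rU] : nbhs x U by exact: open_nbhs_nbhs.
  (* A half-width below [r / 2] and a centre within that half-width of [x] keep the box inside the
     ball of radius [r]. *)
  have r20 : 0 < r / 2 by rewrite divr_gt0.
  have [k _ /(_ k (leqnn k)) kr] := near_infty_natSinv_lt (PosNum r20).
  have /choice[q qx] : forall i : 'I_n, exists q : rat, `|x 0 i - ratr q| < k.+1%:R^-1.
    move=> i; have k0 : 0 < k.+1%:R^-1 :> R by rewrite invr_gt0.
    move: (k.+1%:R^-1 : R) (x 0 i) k0 => e t e0.
    have : t - e < t + e by lra.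
    move=> /rat_in_itvoo[q]; rewrite in_itv/= => /andP[q1 q2].
    by exists q; rewrite ltr_norml; apply/andP; split; lra.
  have boxU : box (\row_i q i, k) `<=` U.
    move=> y yq; apply: rU; split => // i j; rewrite !ord1.
    have := yq j; have := qx j; rewrite /= mxE /ball/=.
    move=> h1 h2.
    apply: (@le_lt_trans _ _ (`|x 0 j - ratr (q j)| + `|y 0 j - ratr (q j)|)).
      by rewrite (le_trans _ (ler_normB _ _))// opprB addrA subrK.
    by rewrite [ltRHS]splitr ltrD// (lt_trans _ kr).
  exists (\row_i q i, k) => //; rewrite asboolT// => i.
  by rewrite mxE.
apply: countable_bigcupT_measurable => [|p]; first exact: countableP.
by case: asboolP.
Qed.

Lemma continuous_on_measurable (R : realType) (n : nat) (Omega : set 'rV[R]_n)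
    (f : 'rV[R]_n -> R) :
  open Omega -> (forall x, Omega x -> {for x, continuous f}) ->
  measurable_fun Omega f.
Proof.
move=> oO cf; apply: (measurability _ (RGenOpens.measurableE R)).
move=> _ [_ [a [b ->] <-]]; apply: open_measurable_rV.
rewrite openE => x [Ox fx]; rewrite /interior; apply: filterI.
  exact: open_nbhs_nbhs.
apply: cf => //; apply: open_nbhs_nbhs; split => //.

Qed.

(** A directional derivative sees only the restriction to a line, so it transfers between functions
    on different spaces that agree along corresponding lines. This serves for coordinate slices and
    for coordinate functions. *)
Lemma is_derive_reparam (R : realType) (V W : normedModType R) (F : V -> R)
    (G : W -> R) (x v : V) (y w : W) (df : R) :
  (forall s : R, G (s *: w + y) = F (s *: v + x)) ->
  is_derive x v F df -> is_derive y w G df.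
Proof.
move=> GF.
have E : (fun s : R => s^-1 *: (G (s *: w + y) - G y)) =
         (fun s : R => s^-1 *: (F (s *: v + x) - F x)).
  have := GF 0; rewrite !scale0r !add0r => ->.
  by apply/funext => s; rewrite GF.
move=> [dF <-]; apply: DeriveDef; first by rewrite /derivable /= E.
by rewrite /derive /= E.
Qed.

Lemma continuous_rV_cons (R : realType) n (t : R) :
  continuous (fun y : 'rV[R]_n => rV_cons (t, y)).
Proof.
move=> y A /nbhs_ballP[e e0 eA]; apply/nbhs_ballP; exists e => // z [_ yz].
apply: eA; split => // i j; rewrite !mxE; case: (unlift ord0 j) => [k|].
  exact: (yz 0 k).
exact: ballxx.
Qed.

Lemma continuous_rV_consl (R : realType) n (y : 'rV[R]_n) :
  continuous (fun t : R => rV_cons (t, y)).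
Proof.
move=> t A /nbhs_ballP[e e0 eA]; apply/nbhs_ballP; exists e => // z tz.
apply: eA; split => // i j; rewrite !mxE; case: (unlift ord0 j) => [k|//].
exact: ballxx.
Qed.

(** A cube rather than a Euclidean ball, because its preimage under [rV_cons] is an interval times a
    lower-dimensional cube. *)
Definition box {R : realType} {n : nat} (B : R) : set 'rV[R]_n :=
  [set x | forall i, `|x 0 i| <= B].

Lemma measurable_box (R : realType) n (B : R) : measurable (@box R n B).
Proof.
rewrite (_ : box _ = \bigcap_(i in [set: 'I_n])
    ((fun y : 'rV[R]_n => y 0 i) @^-1`
       [set` `[- B, B]])); last first.
  apply/seteqP; split=> [y yp i _|y yp i].
    by rewrite /= in_itv/= -ler_norml; exact: yp.
  by have := yp i I; rewrite /= in_itv/= -ler_norml.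
apply: fin_bigcap_measurable; first exact: finite_finset.
by move=> i _; rewrite -[X in measurable X]setTI; apply: measurable_coord.
Qed.

Lemma rV_cons_box (R : realType) n (B t : R) (y : 'rV[R]_n) :
  box B (rV_cons (t, y)) <-> `|t| <= B /\ box B y.
Proof.
split=> [H|[tB yB] i].
  split; first by have := H ord0; rewrite mxE unlift_none.
  by move=> i; have := H (lift ord0 i); rewrite mxE liftK.
by rewrite mxE; case: (unliftP ord0 i) => [j|] _ /=.
Qed.

Lemma lebesgue_box_lty (R : realType) n (B : R) :
  (lebesgue_rV R n (box B) < +oo)%E.
Proof.
elim: n => [|n IH].
  by rewrite /= diracE ltry.
rewrite /= /lebesgue_cons /pushforward.
rewrite (_ : _ @^-1` _ = `[- B, B]%classic `*` box B); last first.
  apply/seteqP; split=> -[t y] /= => [/rV_cons_box|]; rewrite in_itv/= -ler_norml.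
    by [].
  by move=> H; apply/rV_cons_box.
rewrite product_measure1E//; last exact: measurable_box.
apply: lte_mul_pinfty => //.
by rewrite /= lebesgue_measure_itv; case: ifP.
Qed.

Lemma bounded_set_box (R : realType) n (A : set 'rV[R]_n) :
  bounded_set A -> exists2 B : R, 0 < B & A `<=` box B.
Proof.
move=> [M [Mreal MA]]; exists (`|M| + 1); first by rewrite ltr_wpDl.
move=> x Ax i; apply: (le_trans _ (MA (`|M| + 1) _ x Ax)).
  rewrite [leRHS]/Num.Def.normr/= mx_normrE.
  by apply: (le_trans _ (le_bigmax _ _ (ord0, i))).
by rewrite (le_lt_trans (ler_norm M))// ltrDl.
Qed.

(** * Integrals of compactly supported derivatives *)

Lemma integrable_bounded_support d (T : measurableType d) (R : realType)
    (mu : {measure set T -> \bar R}) (A : set T) (h : T -> R) (M : R) :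
  measurable A -> (mu A < +oo)%E -> measurable_fun setT h ->
  (forall x, `|h x| <= M) -> (forall x, ~ A x -> h x = 0) ->
  mu.-integrable setT (EFin \o h).
Proof.
move=> mA muA mh hM h0.
have : mu.-integrable A (EFin \o h).
  apply: measurable_bounded_integrable => //; first exact: measurable_funTS.
  exists M; split; first exact: num_real.
  by move=> N MN x _; exact: (le_trans (hM x) (ltW MN)).
move/(integrable_mkcond _ mA); rewrite restrict_EFin.
rewrite (_ : h \_ A = h)//; apply/funext => x; rewrite patchE.
by case: ifPn => // /negP xA; rewrite h0// => Ax; apply: xA; rewrite inE.
Qed.

(** The fundamental theorem of calculus on an interval whose endpoints lie where [F] vanishes. *)
Lemma integral_derivative_compact (R : realType) (F h : R -> R) (B : R) :
  continuous h -> (forall t, ~ `|t| <= B -> F t = 0 /\ h t = 0) ->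
  (forall t : R, is_derive t (1 : R) F (h t)) ->
  (\int[lebesgue_measure]_t (h t)%:E = 0)%E.
Proof.
move=> ch F0 dF.
(* Whatever the sign of [B], the number |B| + 1 is positive and exceeds [B], so the interval is
   non-degenerate and [F] vanishes at both ends. *)
have B1 : ~ `| `|B| + 1| <= B.
  apply/negP; rewrite -ltNge ger0_norm ?addr_ge0//.
  by rewrite (le_lt_trans (ler_norm B))// ltrDl.
have dF' t : derivable F t 1 by case: (dF t).
have cF : continuous F.
  by move=> t; apply/differentiable_continuous/derivable1_diffP.
transitivity (\int[lebesgue_measure]_(t in `[(- (`|B| + 1))%R, (`|B| + 1)%R])
  (h t)%:E)%E.
  rewrite [RHS]integral_mkcond; apply: eq_integral => t _; rewrite patchE.
  case: ifPn => // /negP; rewrite inE /= in_itv/= -ler_norml => /negP.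
  rewrite -ltNge => Bt; rewrite (F0 t _).2//.
  apply/negP; rewrite -ltNge (le_lt_trans _ Bt)// (le_trans (ler_norm B))//.
  by rewrite lerDl.
rewrite (@continuous_FTC2 _ h F).
- by rewrite (F0 _ B1).1 (F0 (- _) _).1 ?subee// normrN.
- by rewrite gtrN// ltr_wpDl.
- exact: continuous_subspaceT.
- by split; [move=> t _; exact: dF'|apply: cvg_at_right_filter; exact: cF|
    apply: cvg_at_left_filter; exact: cF].
- by move=> t _; rewrite derive1E; case: (dF t).
Qed.

Lemma rV_consD_scale0 (R : realType) n (t s : R) (y : 'rV[R]_n) :
  rV_cons (s *: 1 + t, y) = s *: unitv R ord0 + rV_cons (t, y).
Proof.
apply/rowP => j; rewrite !mxE; case: (unliftP ord0 j) => [k ->|->] /=.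
  by rewrite mulr0 add0r.
by [].
Qed.

Lemma rV_consD_scale_lift (R : realType) n (t s : R) (y : 'rV[R]_n) (k : 'I_n) :
  rV_cons (t, s *: unitv R k + y) = s *: unitv R (lift ord0 k) + rV_cons (t, y).
Proof.
apply/rowP => j; rewrite !mxE; case: (unliftP ord0 j) => [l ->|->] /=.
  by rewrite !mxE/= (inj_eq lift_inj).
by rewrite mulr0 add0r.
Qed.

(** Being bounded and supported in a box, [h] is integrable for the product measure, so Fubini
    permits either order of integration. Slices keep the same [B] and [M], which stay fixed in the
    induction on the dimension. *)
Lemma integral_partial_compact (R : realType) n (i : 'I_n) (F h : 'rV[R]_n -> R)
    (B M : R) :
  continuous h -> (forall x, `|h x| <= M) ->
  (forall x, ~ box B x -> F x = 0 /\ h x = 0) ->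
  (forall x, is_derive x (unitv R i) F (h x)) ->
  (\int[lebesgue_rV R n]_x (h x)%:E = 0)%E.
Proof.
elim: n i F h => [[]//|n IH] i F h ch hM F0 dF.
have mh : measurable_fun setT h.
  by apply: continuous_on_measurable; [exact: openT|move=> x _; exact: ch].
have mhc : measurable_fun setT (h \o @rV_cons R n : measurableTypeR R * 'rV[R]_n -> R).
  exact: (measurableT_comp mh (@measurable_rV_cons R n)).
have ih : (@lebesgue_measure R \x lebesgue_rV R n)%E.-integrable setT
    (EFin \o (h \o @rV_cons R n)).
  refine (@integrable_bounded_support _ _ _
    (@lebesgue_measure R \x lebesgue_rV R n)%E (@rV_cons R n @^-1` box B)
    (h \o @rV_cons R n) M _ _ _ _ _) => //.
  - rewrite -[X in measurable X]setTI; apply: measurable_rV_cons => //.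
    exact: measurable_box.
  - exact: (@lebesgue_box_lty R n.+1 B).
  - by move=> x; exact: hM.
  - by move=> x /= /F0[].
rewrite /= integral_pushforward//=; last 2 first.
  - exact: measurable_rV_cons.
  - exact/measurable_EFinP.
rewrite preimage_setT.
(* If i is not the first coordinate, integrate over the other coordinates first
   and use induction; otherwise integrate along the first one. *)
case: (unliftP ord0 i) => [k|] iE.
  rewrite -[LHS]integral12_prod_meas1//.
  transitivity (\int[@lebesgue_measure R]_t (0 : \bar R))%E; last exact: integral0.
  apply: eq_integral => t _.
  apply: (IH k (fun y => F (rV_cons (t, y))) (fun y => h (rV_cons (t, y)))).
  - move=> y; apply: continuous_comp; first exact: continuous_rV_cons.
    exact: ch.
  - by move=> y; exact: hM.
  - by move=> y yB; apply: F0 => /rV_cons_box[].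
  - move=> y; apply: is_derive_reparam (dF (rV_cons (t, y))) => s.
    by rewrite rV_consD_scale_lift iE.
rewrite -[LHS]integral21_prod_meas1//.
transitivity (\int[lebesgue_rV R n]_y (0 : \bar R))%E; last exact: integral0.
apply: eq_integral => y _.
apply: (@integral_derivative_compact _ (fun t => F (rV_cons (t, y)))
  (fun t => h (rV_cons (t, y))) B).
- move=> t; apply: continuous_comp; first exact: continuous_rV_consl.
  exact: ch.
- by move=> t tB; apply: F0 => /rV_cons_box[].
- move=> t; apply: is_derive_reparam (dF (rV_cons (t, y))) => s.
  by rewrite rV_consD_scale0 iE.
Qed.

(** * Integration by parts *)

Section compact_support.
Context {R : realType} {n : nat}.
Implicit Types (K Omega : set 'rV[R]_n) (f w phi : 'rV[R]_n -> R).

Lemma compact_support_bounded K f :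
  compact K -> (forall x, ~ K x -> f x = 0) -> continuous f ->
  exists M, forall x, `|f x| <= M.
Proof.
move=> cK f0 cf.
have /compact_bounded[M [_ KM]] : compact (f @` K).
  by apply: continuous_compact => //; exact: continuous_subspaceT.
exists (`|M| + 1) => x; have M1 : M < `|M| + 1.
  by rewrite (le_lt_trans (ler_norm M))// ltrDl.
have [Kx|/f0 ->] := pselect (K x); last by rewrite normr0 addr_ge0.
by apply: (KM _ M1); exists x.
Qed.

Lemma compact_support_integrable K f :
  compact K -> (forall x, ~ K x -> f x = 0) -> continuous f ->
  (lebesgue_rV R n).-integrable setT (EFin \o f).
Proof.
move=> cK f0 cf; have [M fM] := compact_support_bounded K f cK f0 cf.
have [B _ KB] := bounded_set_box _ _ _ (compact_bounded cK).
apply: (@integrable_bounded_support _ _ _ _ (box B) f M) => //.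
- exact: measurable_box.
- exact: lebesgue_box_lty.
- by apply: continuous_on_measurable; [exact: openT|move=> x _; exact: cf].
- by move=> x Bx; apply: f0 => /KB.
Qed.

(** Nothing is known of [w] off [Omega], but such points lie in the open complement of [K], where
    the product vanishes identically. *)
Lemma continuous_mul_support Omega K w phi : closed K -> K `<=` Omega ->
  (forall x, Omega x -> {for x, continuous w}) -> continuous phi ->
  (forall x, ~ K x -> phi x = 0) -> continuous (fun x => w x * phi x).
Proof.
move=> cK KO cw cphi phi0 x.
have [Ox|Ox] := pselect (Omega x).
  exact: (@continuousM _ _ w phi x (cw x Ox) (cphi x)).
have Kx : (~` K) x by move=> /KO.
rewrite /continuous_at phi0// mulr0; apply: cvg_near_cst; first exact: (nbhs_filter x).
have : nbhs x (~` K).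
  by apply: open_nbhs_nbhs; split => //; exact: closed_openC.
by apply: (@filterS _ _ (nbhs_filter x)) => y /phi0 ->; rewrite mulr0.
Qed.

Lemma integral_support Omega f : measurable Omega ->
  (forall x, ~ Omega x -> f x = 0) ->
  (\int[lebesgue_rV R n]_(x in Omega) (f x)%:E =
   \int[lebesgue_rV R n]_x (f x)%:E)%E.
Proof.
move=> mO f0; rewrite integral_mkcond; apply: eq_integral => x _.
rewrite patchE; case: ifPn => // /negP xO; rewrite f0// => Ox.
by apply: xO; rewrite inE.
Qed.

End compact_support.

Section test_functions.
Context {R : realType} {n : nat}.
Implicit Types (Omega : set 'rV[R]_n) (f w phi : 'rV[R]_n -> R).

(** Off its closed support [phi] vanishes on a neighbourhood, hence so do its partial
    derivatives. *)
Lemma test_function_support {Omega phi} : test_function Omega phi ->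
  exists K, [/\ compact K, closed K, K `<=` Omega,
    forall x, ~ K x -> phi x = 0 &
    forall i x, ~ K x -> 'D_(unitv R i) phi x = 0].
Proof.
move=> [_ cK KO]; exists (closure [set x | phi x != 0]).
have phi0 x : ~ closure [set x | phi x != 0] x -> phi x = 0.
  by move=> Kx; apply/eqP/negPn/negP => phix; apply: Kx; exact: subset_closure.
split => //; first exact: closed_closure.
move=> i x Kx; rewrite (_ : 'D_(unitv R i) phi x = 'D_(unitv R i) (cst 0) x).
  exact: derive_cst.
apply: near_eq_derive.
have : nbhs x (~` closure [set x | phi x != 0]).
  by apply: open_nbhs_nbhs; split => //; apply: closed_openC; exact: closed_closure.
by apply: (@filterS _ _ (nbhs_filter x)) => y /phi0 ->.
Qed.

Lemma test_function_continuous {Omega phi} : test_function Omega phi ->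
  [/\ continuous phi, forall i, continuous ('D_(unitv R i) phi) &
      forall i x, derivable phi x (unitv R i)].
Proof.
move=> [C _ _]; have [cphi dphi] := C 1%N; split.
- by move=> x; exact: cphi.
- by move=> i x; have [_ [cD _]] := dphi i; exact: cD.
- by move=> i x; have [H _] := dphi i; exact: H.
Qed.

(** Integration by parts without boundary term: the product of [w] and [phi] has compact support and
    continuous partial derivative [p \+ q], whose integral over the whole space is therefore
    zero. *)
Lemma weak_partial_C1 Omega i w : open Omega ->
  (forall x, Omega x -> {for x, continuous w}) ->
  (forall x, Omega x -> derivable w x (unitv R i)) ->
  (forall x, Omega x -> {for x, continuous ('D_(unitv R i) w)}) ->
  weak_partial Omega i w ('D_(unitv R i) w).
Proof.
move=> oO cw dw cDw phi tphi.
have [K [cK clK KO phi0 dphi0]] := test_function_support tphi.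
have [cphi cdphi dphi] := test_function_continuous tphi.
have mO := open_measurable_rV _ _ _ oO.
pose p x := w x * 'D_(unitv R i) phi x.
pose q x := 'D_(unitv R i) w x * phi x.
have p0 x : ~ K x -> p x = 0 by move=> Kx; rewrite /p dphi0// mulr0.
have q0 x : ~ K x -> q x = 0 by move=> Kx; rewrite /q phi0// mulr0.
have cp : continuous p.
  by apply: (@continuous_mul_support _ _ Omega K) => //; exact: dphi0.
have cq : continuous q by exact: (@continuous_mul_support _ _ Omega K).
rewrite (@integral_support _ _ Omega p)//; last by move=> x Ox; apply: p0 => /KO.
rewrite (@integral_support _ _ Omega q)//; last by move=> x Ox; apply: q0 => /KO.
have ip := compact_support_integrable K p cK p0 cp.
have iq := compact_support_integrable K q cK q0 cq.
have cpq : continuous (p \+ q) by move=> x; exact: (continuousD (cp x) (cq x)).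
have pq0 x : ~ K x -> (p \+ q) x = 0 by move=> Kx; rewrite /= p0// q0// addr0.
have [M hM] := compact_support_bounded K _ cK pq0 cpq.
have [B _ KB] := bounded_set_box _ _ _ (compact_bounded cK).
(* The product rule applies inside [Omega]; elsewhere the product is zero near the point. *)
have dpq x : is_derive x (unitv R i) (fun y => w y * phi y) ((p \+ q) x).
  have [Ox|Ox] := pselect (Omega x).
    have dwx := derivableP (dw x Ox); have dphix := derivableP (dphi i x).
    rewrite /= /p /q.
    rewrite (_ : _ + _ = w x *: 'D_(unitv R i) phi x
                         + phi x *: 'D_(unitv R i) w x); last first.
      by rewrite /GRing.scale/= [phi x * _]mulrC.
    exact: is_deriveM.
  have Kx : ~ K x by move=> /KO.
  rewrite pq0//; apply: (@near_eq_is_derive _ _ _ (cst 0)).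
    have : nbhs x (~` K) by apply: open_nbhs_nbhs; split => //; exact: closed_openC.
    by apply: (@filterS _ _ (nbhs_filter x)) => y /phi0 ->; rewrite mulr0.
have := @integral_partial_compact _ _ i _ _ B M cpq hM _ dpq.
have H : forall x : 'rV_n, ~ box B x -> w x * phi x = 0 /\ (p \+ q) x = 0.
  move=> x Bx; have Kx : ~ K x by move=> /KB.
  by rewrite pq0// phi0// mulr0.
move=> /(_ H); rewrite (_ : (fun x => _) = (EFin \o p) \+ (EFin \o q))%E//.
rewrite [X in X = _ -> _]integralD// => pq.
(* The integral of [q] is finite, so it may be cancelled in the extended reals. *)
rewrite -[LHS](addeK _ (integrable_fin_num measurableT iq)).
by rewrite [X in (X - _)%E]pq add0e.
Qed.

End test_functions.

(** * The L^2 norm *)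

Section L2norm.
Context {R : realType} {n : nat} {Omega : set 'rV[R]_n}.
Hypothesis mO : measurable Omega.
Implicit Types f g : 'rV[R]_n -> R.
Local Notation mu := (lebesgue_rV R n).
Local Open Scope ereal_scope.

Lemma L2norm_ge0 f : 0 <= L2norm Omega f.
Proof. exact: Lnorm_ge0. Qed.

Lemma L2normE f :
  L2norm Omega f = (\int[mu]_(x in Omega) ((f x) ^+ 2)%:E) `^ (2^-1).
Proof.
rewrite /L2norm /Lpnorm unlock; congr (_ `^ _); rewrite [RHS]integral_mkcond.
apply: eq_integral => x _; rewrite /= !patchE; case: ifPn => _.
  by rewrite powR_mulrn// -normrX ger0_norm// sqr_ge0.
by rewrite normr0 powR0.
Qed.

Let msq f : measurable_fun Omega f ->
  measurable_fun Omega (fun x => ((f x) ^+ 2)%:E).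
Proof. by move=> mf; apply/measurable_EFinP; exact: measurable_funX. Qed.

Lemma L2norm_ae_le f g : measurable_fun Omega f -> measurable_fun Omega g ->
  {ae mu, forall x, Omega x -> (`|f x| <= `|g x|)%R} ->
  L2norm Omega f <= L2norm Omega g.
Proof.
move=> mf mg fg; rewrite !L2normE gt0_ler_poweR//.
- by rewrite in_itv/= leey integral_ge0// => x _; rewrite lee_fin sqr_ge0.
- by rewrite in_itv/= leey integral_ge0// => x _; rewrite lee_fin sqr_ge0.
apply: ae_ge0_le_integral => //.
- by move=> x _; rewrite lee_fin sqr_ge0.
- exact: msq.
- by move=> x _; rewrite lee_fin sqr_ge0.
- exact: msq.
apply: filterS fg => x fg Ox; rewrite lee_fin -[(f x ^+ 2)%R]ger0_norm ?sqr_ge0//.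
rewrite -[(g x ^+ 2)%R]ger0_norm ?sqr_ge0// !normrX lerXn2r ?nnegrE//.
exact: fg.
Qed.

Lemma L2norm_ae_eq f g : measurable_fun Omega f -> measurable_fun Omega g ->
  {ae mu, forall x, Omega x -> (`|f x| = `|g x|)%R} ->
  L2norm Omega f = L2norm Omega g.
Proof.
move=> mf mg fg; apply/eqP; rewrite eq_le; apply/andP; split.
  by apply: L2norm_ae_le => //; apply: filterS fg => x fg /fg ->.
by apply: L2norm_ae_le => //; apply: filterS fg => x fg /fg ->.
Qed.

Lemma L2norm_abs f : measurable_fun Omega f ->
  L2norm Omega (fun x => `|f x|%R) = L2norm Omega f.
Proof.
move=> mf; apply: L2norm_ae_eq => //; first exact: measurableT_comp.
by apply/nearW => x _; rewrite normr_id.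
Qed.

Lemma L2normD_le f g : measurable_fun Omega f -> measurable_fun Omega g ->
  L2norm Omega (fun x => f x + g x)%R <= L2norm Omega f + L2norm Omega g.
Proof.
move=> mf mg; rewrite /L2norm /Lpnorm.
rewrite (_ : (fun x => (f x + g x)%R) \_ Omega =
  (f \_ Omega \+ g \_ Omega)%R); last first.
  by apply/funext => x; rewrite /= !patchE; case: ifPn => // _; rewrite addr0.
by apply: minkowski_EFin; rewrite ?ler1n//; exact: (measurable_restrictT _ mO).1.
Qed.

Lemma L2normZ (c : R) f : measurable_fun Omega f -> (0 <= c)%R ->
  L2norm Omega (fun x => c * f x)%R = c%:E * L2norm Omega f.
Proof.
move=> mf c0; rewrite !L2normE.
under eq_integral => x _ do rewrite exprMn EFinM.
rewrite ge0_integralZl//; last 3 first.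
- exact: msq.
- by move=> x _; rewrite lee_fin sqr_ge0.
- by rewrite lee_fin sqr_ge0.
rewrite poweRM ?lee_fin ?sqr_ge0//; last first.
  by apply: integral_ge0 => x _; rewrite lee_fin sqr_ge0.
by rewrite poweR_EFin -powR_mulrn// -powRrM mulfV// powRr1.
Qed.

Lemma L2norm_sum (I : Type) (r : seq I) (f : I -> 'rV[R]_n -> R) :
  (forall i, measurable_fun Omega (f i)) ->
  L2norm Omega (fun x => \sum_(i <- r) f i x)%R <=
  \sum_(i <- r) L2norm Omega (f i).
Proof.
move=> mf; elim: r => [|i r IH].
  rewrite big_nil L2normE; under eq_integral => x _ do rewrite big_nil expr0n.
  by rewrite integral0 poweR0r// invr_neq0.
rewrite big_cons; under eq_fun => x do rewrite big_cons.
apply: le_trans (leeD (lexx _) IH); apply: L2normD_le => //.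
exact: measurable_sum.
Qed.

Lemma L2norm_bounded f (M : R) : mu Omega < +oo -> measurable_fun Omega f ->
  (forall x, Omega x -> (`|f x| <= M)%R) -> L2norm Omega f < +oo.
Proof.
move=> Oy mf fM; apply: (@le_lt_trans _ _ (L2norm Omega (cst M))).
  apply: L2norm_ae_le => //; apply/nearW => x Ox /=.
  by rewrite (le_trans (fM x Ox))// ler_norm.
rewrite L2normE poweR_lty// (integral_cst _ mO (M ^+ 2)%:E).
by rewrite lte_mul_pinfty// lee_fin sqr_ge0.
Qed.

End L2norm.

(** * Coercivity under the Cordes condition *)

(** With c = t / S, the trace of [h] splits as c (a : h) + (I - c a) : h. This c minimizes the
    Frobenius norm of I - c a, whose square becomes d - t^2 / S and is at most 1 - eps by the Cordes
    bound. Bounding each entry by the Frobenius norm suits the H^2 seminorm, which is a sum over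
    entries. *)
Lemma cordes_pointwise (R : realType) (d : nat) (a h : 'I_d -> 'I_d -> R)
    (lam eps : R) : (0 < d)%N -> 0 < lam -> 0 < eps ->
  (forall i, lam <= a i i) ->
  (\sum_i \sum_j (a i j) ^+ 2) / (\sum_i a i i) ^+ 2 <= 1 / (d%:R - 1 + eps) ->
  `|\sum_i h i i| <= lam^-1 * `|\sum_i \sum_j a i j * h i j|
                     + Num.sqrt (1 - eps) * \sum_i \sum_j `|h i j|.
Proof.
move=> d0 lam0 eps0 alam.
set S := \sum_i \sum_j _; set t := \sum_i a i i => St.
have d1 : 1 <= d%:R :> R by rewrite ler1n.
have lamt : d%:R * lam <= t.
  rewrite (_ : d%:R * lam = \sum_(i < d) lam); last first.
    by rewrite sumr_const card_ord mulr_natl.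
  by apply: ler_sum => i _.
have t0 : 0 < t by rewrite (lt_le_trans _ lamt)// mulr_gt0// ltr0n.
(* Only the diagonal squares are kept, each at least [lam] times the diagonal entry; this yields c
   <= 1 / lam below. *)
have tS : lam * t <= S.
  rewrite mulr_sumr; apply: ler_sum => i _; rewrite (bigD1 i)//=.
  rewrite ler_wpDr//; first by apply: sumr_ge0 => j _; rewrite sqr_ge0.
  by rewrite expr2 ler_wpM2r// (le_trans _ (alam i))// ltW.
have S0 : 0 < S by rewrite (lt_le_trans _ tS)// mulr_gt0.
pose c := t / S.
have c0 : 0 < c by rewrite divr_gt0.
have clam : c <= lam^-1 by rewrite /c ler_pdivrMr// ler_pdivlMl.
have tS2 : d%:R - 1 + eps <= t ^+ 2 / S.
  have e0 : 0 < d%:R - 1 + eps by rewrite ltr_wpDl// subr_ge0.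
  move: St; rewrite div1r ler_pdivrMr ?exprn_gt0// ler_pdivlMl// => H.
  by rewrite ler_pdivlMr.
pose m i j := (i == j)%:R - c * a i j.
(* Expanding gives d - 2 c t + c^2 S, since the identity matrix meets [a] only on the diagonal; the
   choice of c then collapses the sum. *)
have mS : \sum_i \sum_j (m i j) ^+ 2 = d%:R - t ^+ 2 / S.
  transitivity (\sum_i \sum_j
    ((i == j)%:R - c * 2 * ((i == j)%:R * a i j) + c ^+ 2 * (a i j) ^+ 2)).
    apply: eq_bigr => i _; apply: eq_bigr => j _; rewrite /m.
    by case: (i == j); rewrite ?mulr1n ?mulr0n; ring.
  transitivity (\sum_(i < d) (1 - c * 2 * a i i + c ^+ 2 * \sum_j (a i j) ^+ 2)).
    apply: eq_bigr => i _; rewrite big_split sumrB -!mulr_sumr; congr (_ - _ * _ + _).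
      rewrite (bigD1 i)//= eqxx big1 ?addr0// => j /negbTE.
      by rewrite eq_sym => ->.
    rewrite (bigD1 i)//= eqxx mul1r big1 ?addr0// => j /negbTE.
    by rewrite eq_sym => ->; rewrite mul0r.
  rewrite big_split sumrB -!mulr_sumr sumr_const card_ord -/S -/t /c.
  by rewrite /=; field; rewrite gt_eqF.
have mle i j : `|m i j| <= Num.sqrt (1 - eps).
  rewrite -sqrtr_sqr ler_wsqrtr//.
  apply: (@le_trans _ _ (d%:R - t ^+ 2 / S)); last first.
    by move: tS2; lra.
  rewrite -mS (bigD1 i)//= (bigD1 j)//= -addrA ler_wpDr//.
  rewrite addr_ge0//; first by apply: sumr_ge0 => k _; rewrite sqr_ge0.
  by apply: sumr_ge0 => k _; apply: sumr_ge0 => l _; rewrite sqr_ge0.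
have -> : \sum_i h i i =
    c * (\sum_i \sum_j a i j * h i j) + \sum_i \sum_j m i j * h i j.
  rewrite mulr_sumr -big_split; apply: eq_bigr => i _ /=.
  rewrite mulr_sumr -big_split/= (bigD1 i)//= /m eqxx big1 ?addr0 ?mulr1n.
    by ring.
  by move=> j /negbTE; rewrite eq_sym => ->; rewrite mulr0n; ring.
apply: (le_trans (ler_normD _ _)); apply: lerD.
  by rewrite normrM (gtr0_norm c0) ler_wpM2r.
rewrite mulr_sumr; apply: (le_trans (ler_norm_sum _ _ _)); apply: ler_sum => i _.
rewrite mulr_sumr; apply: (le_trans (ler_norm_sum _ _ _)); apply: ler_sum => j _.
by rewrite normrM ler_wpM2r.
Qed.

(** The quadratic form is evaluated at the unit vector of index [i]. *)
Lemma elliptic_diag (R : realType) (d : nat) (Omega : set 'rV[R]_d)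
    (a : coefficients R d) (lam Lam : R) :
  elliptic Omega a lam Lam -> forall x i, Omega x -> lam <= a i i x.
Proof.
move=> ell x i Ox; have e0 : unitv R i != 0.
  by apply/eqP => /rowP/(_ i); rewrite !mxE !eqxx => /eqP; rewrite oner_eq0.
have /andP[+ _] := ell _ x e0 Ox.
rewrite (bigD1 i)//= big1 ?addr0; last first.
  by move=> j /negbTE ji; rewrite !mxE ji andbF expr0n.
rewrite (bigD1 i)//= [X in _ <= _ + X]big1 ?addr0; last first.
  move=> k /negbTE ki; apply: big1 => j _; rewrite !mxE ki andbF.
  by rewrite mulr0 mul0r.
rewrite (bigD1 i)//= big1 ?addr0; last first.
  by move=> j /negbTE ji; rewrite !mxE ji andbF mulr0.
by rewrite !mxE !eqxx expr1n !mulr1.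
Qed.

Lemma measurable_Lop (R : realType) (d : nat) (Omega : set 'rV[R]_d)
    (a : coefficients R d) (v : jet R d) :
  (forall i j, measurable_fun Omega (a i j)) ->
  (forall i j, measurable_fun Omega (jhess v i j)) ->
  measurable_fun Omega (Lop a v).
Proof.
move=> ma mv; apply: measurable_sum => i; apply: measurable_sum => j.
exact: measurable_funM.
Qed.

(** Taking L^2 norms in the pointwise bound gives A |v| <= |L v| / lam + s |v| in the H^2 norm, with
    s = sqrt (1 - eps) < A; the last term is absorbed on the left. *)
Lemma cordes_coercive (R : realType) (d : nat) (Omega : set 'rV[R]_d)
    (a : coefficients R d) (lam Lam eps A : R) :
  measurable Omega -> (0 < d)%N ->
  (forall i j, measurable_fun Omega (a i j)) -> 0 < lam ->
  elliptic Omega a lam Lam -> 0 < eps -> cordes Omega a eps ->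
  0 < A -> H2_coercive Omega (@laplacian R d) A -> 1 - A ^+ 2 < eps ->
  H2_coercive Omega (Lop a) (lam * (A - Num.sqrt (1 - eps))).
Proof.
move=> mO d0 ma lam0 ell eps0 cor A0 lapA Aeps v vH2 vH10.
have [_ hv] := vH2.
have mh i j : measurable_fun Omega (jhess v i j) by have [[]] := hv i j.
have hfin i j : (L2norm Omega (jhess v i j) < +oo)%E by have [[_ ?] _] := hv i j.
have mL : measurable_fun Omega (Lop a v) by exact: measurable_Lop.
have mlap : measurable_fun Omega (laplacian v) by exact: measurable_sum.
have mH : measurable_fun Omega (fun x => \sum_i \sum_j `|jhess v i j x|).
  by apply: measurable_sum => i; apply: measurable_sum => j; exact: measurableT_comp.
have mLa : measurable_fun Omega (fun x => `|Lop a v x|) by exact: measurableT_comp.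
set s := Num.sqrt (1 - eps).
have s0 : 0 <= s by exact: sqrtr_ge0.
have sA : s < A.
  rewrite -(gtr0_norm A0) -sqrtr_sqr ltr_sqrt ?exprn_gt0//.
  by move: Aeps; lra.
have lam0' : 0 <= lam^-1 by rewrite invr_ge0 ltW.
have lapv := lapA v vH2 vH10.
(* Absorption needs a finite norm. The Laplacian has finite L^2 norm as a sum of second derivatives,
   and its coercivity passes this on to the full H^2 norm. *)
have H2y : (H2norm Omega v < +oo)%E.
  have : (L2norm Omega (laplacian v) < +oo)%E.
    apply: (le_lt_trans (L2norm_sum mO _ _ (fun i => jhess v i i) _)) => //.
    by apply: lte_sum_pinfty => i _.
  move=> /(le_lt_trans lapv); case: (H2norm Omega v) => [h| |] //.
    by rewrite !ltry.
  by rewrite gt0_muley// lte_fin.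
have H20 : (0 <= H2norm Omega v)%E.
  rewrite /H2norm; apply: adde_ge0; first by apply: adde_ge0; exact: L2norm_ge0.
  by apply: sume_ge0 => i _; apply: sume_ge0 => j _; exact: L2norm_ge0.
have semi : (L2norm Omega (fun x => \sum_i \sum_j `|jhess v i j x|)%R
             <= H2norm Omega v)%E.
  apply: (@le_trans _ _ (H2seminorm Omega v)); last first.
    by rewrite /H2norm leeDr//; apply: adde_ge0; exact: L2norm_ge0.
  apply: (le_trans (L2norm_sum mO _ _ (fun i x => \sum_j `|jhess v i j x|) _)).
    by move=> i; apply: measurable_sum => j; exact: measurableT_comp.
  apply: lee_sum => i _.
  apply: (le_trans (L2norm_sum mO _ _ (fun j x => `|jhess v i j x|) _)).
    by move=> j; exact: measurableT_comp.
  by apply: lee_sum => j _; rewrite L2norm_abs.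
have key : (A%:E * H2norm Omega v
    <= lam^-1%:E * L2norm Omega (Lop a v) + s%:E * H2norm Omega v)%E.
  apply: (le_trans lapv).
  apply: (@le_trans _ _ (L2norm Omega (fun x =>
    lam^-1 * `|Lop a v x| + s * \sum_i \sum_j `|jhess v i j x|)%R)).
    apply: L2norm_ae_le => //.
      by apply: measurable_funD; exact: measurable_funM.
    apply: filterS cor => x cx Ox.
    rewrite [leRHS]ger0_norm; last first.
      by rewrite addr_ge0// mulr_ge0// sumr_ge0// => i _; rewrite sumr_ge0.
    apply: (cordes_pointwise _ _ (fun i j => a i j x)
      (fun i j => jhess v i j x)) => //.
      by move=> i; exact: (elliptic_diag _ _ _ _ _ _ ell).
    exact: cx.
  apply: (le_trans (L2normD_le mO _ _ _ _)) => //;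
    [exact: measurable_funM|exact: measurable_funM|].
  rewrite !L2normZ// L2norm_abs// leeD2l// lee_wpmul2l// lee_fin.
(* Only a real value of |L v| calls for arithmetic; the bound is trivial when it is infinite. *)
have : (0 <= L2norm Omega (Lop a v))%E by exact: L2norm_ge0.
move: key H20 H2y; move: (L2norm _ (Lop a v)) (H2norm Omega v) => [l| |] [h| |]//.
move=> + _ _ _; rewrite -!EFinM -EFinD !lee_fin => key.
  by rewrite -mulrA -ler_pdivlMl//; move: key; rewrite mulrBl; lra.
by move=> *; rewrite leey.
Qed.

(** * Splines *)

Section polynomial_functions.
Context {R : realType} {n : nat}.
Implicit Types f g : 'rV[R]_n -> R.

(** A predicate on functions, so that continuity, differentiability and boundedness on cubes follow
    by induction and apply to the pieces of a spline. *)
Inductive polyfun : ('rV[R]_n -> R) -> Prop :=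
| polyfun_cst c : polyfun (cst c)
| polyfun_coord i : polyfun (fun x => x 0 i)
| polyfunD f g : polyfun f -> polyfun g -> polyfun (f + g)
| polyfunM f g : polyfun f -> polyfun g -> polyfun (f * g).

Lemma polyfun_sum (I : Type) (r : seq I) (P : pred I) (f : I -> 'rV[R]_n -> R) :
  (forall i, polyfun (f i)) -> polyfun (fun x => \sum_(i <- r | P i) f i x).
Proof.
move=> pf; rewrite (_ : (fun x => _) = \sum_(i <- r | P i) f i); last first.
  by apply/funext => x; rewrite fct_sumE.
by elim/big_ind : _ => //; [exact: (polyfun_cst 0)|exact: polyfunD].
Qed.

Lemma polyfun_prod (I : Type) (r : seq I) (P : pred I)
    (f : I -> 'rV[R]_n -> R) :
  (forall i, polyfun (f i)) -> polyfun (fun x => \prod_(i <- r | P i) f i x).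
Proof.
move=> pf; elim: r => [|i r IH].
  by under eq_fun do rewrite big_nil; exact: (polyfun_cst 1).
under eq_fun do rewrite big_cons; case: (P i) => //.
exact: polyfunM.
Qed.

Lemma polyfunX f k : polyfun f -> polyfun (fun x => f x ^+ k).
Proof.
move=> pf; elim: k => [|k IH]; first exact: (polyfun_cst 1).
by under eq_fun do rewrite exprS; exact: polyfunM.
Qed.

Lemma polyfun_continuous f : polyfun f -> continuous f.
Proof.
elim=> {f} [c|i|f g _ cf _ cg|f g _ cf _ cg] x.
- exact: cst_continuous.
- exact: coord_continuous.
- exact: (continuousD (cf x) (cg x)).
- exact: (continuousM (cf x) (cg x)).
Qed.

Lemma polyfun_derive f v : polyfun f ->
  (forall x, derivable f x v) /\ polyfun (fun x => 'D_v f x).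
Proof.
elim=> {f} [c|i|f g pf [df pdf] pg [dg pdg]|f g pf [df pdf] pg [dg pdg]].
- split; first by move=> x; exact: derivable_cst.
  rewrite (_ : (fun x => _) = cst 0); first exact: polyfun_cst.
  by apply/funext => x; exact: derive_cst.
(* Along a line of direction [v] the coordinate is affine with slope [v 0 i], so its derivative is
   that of the identity of R in direction [v 0 i]. *)
- have H (x : 'rV[R]_n) : is_derive x v (fun y : 'rV[R]_n => y 0 i) (v 0 i).
    apply: (is_derive_reparam _ _ _ id _ (x 0 i) (v 0 i)) (is_derive_id _ _).
    by move=> s; rewrite !mxE.
  split; first by move=> x; case: (H x).
  rewrite (_ : (fun x => _) = cst (v 0 i)); first exact: polyfun_cst.
  by apply/funext => x; case: (H x).
- split; first by move=> x; exact: derivableD.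
  rewrite (_ : (fun x => _) = (fun x => 'D_v f x) + (fun x => 'D_v g x)).
    exact: polyfunD.
  by apply/funext => x; rewrite deriveD.
- split; first by move=> x; exact: derivableM.
  rewrite (_ : (fun x => _) = f * (fun x => 'D_v g x) + g * (fun x => 'D_v f x)).
    by apply: polyfunD; exact: polyfunM.
  by apply/funext => x; rewrite deriveM.
Qed.

Lemma polyfun_bounded f (B : R) : polyfun f ->
  exists M, forall x, box B x -> `|f x| <= M.
Proof.
elim=> {f} [c|i|f g _ [M fM] _ [N gN]|f g _ [M fM] _ [N gN]].
- by exists `|c|.
- by exists B => x; exact.
- exists (M + N) => x Bx; rewrite (le_trans (ler_normD _ _))// lerD//.
    exact: fM.
  exact: gN.
- by exists (M * N) => x Bx; rewrite normrM ler_pM// ?fM ?gN.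
Qed.

End polynomial_functions.

Section pieces.
Context {R : realType} {d : nat}.
Implicit Types (v : simplex_vertices R d).

(** The matrix applied to (1, x) does not depend on x, so barycentric coordinates are affine in
    x. *)
Lemma polyfun_bary v k : polyfun (fun x : 'rV[R]_d => bary v x k).
Proof.
rewrite /bary; under eq_fun do rewrite mxE.
apply: polyfun_sum => j; apply: polyfunM; last exact: polyfun_cst.
under eq_fun do rewrite mxE.
by case: (fintype.split j) => i; [exact: polyfun_cst|exact: polyfun_coord].
Qed.

Lemma closed_simplex v : closed (simplex v).
Proof.
rewrite (_ : simplex v = \bigcap_(k in [set: 'I_d.+1])
    ((fun x => bary v x k) @^-1` [set t | 0 <= t])); last first.
  apply/seteqP; split=> [x vx k _|x vx k]; first by have [] := vx k.
  by rewrite inE; split => //; exact: (vx k).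
apply: closed_bigI => k _; apply: preimage_closed; last exact: closed_ge.
by move=> x _; exact: (polyfun_continuous _ (polyfun_bary v k)).
Qed.

Lemma polyfun_piece N (T : 'I_N -> simplex_vertices R d) D
    (c : 'cV[R]_(ncoef d N D)) t : polyfun (piece T c t).
Proof.
apply: polyfun_sum => i; apply: polyfunM; first exact: polyfun_cst.
apply: polyfunM; first exact: polyfun_cst.
by apply: polyfun_prod => k; apply: polyfunX; exact: polyfun_bary.
Qed.

End pieces.

(* Spares a proof that a simplex is the closure of its interior. *)
Lemma closed_cover_interior (X : topologicalType) (I : eqType) (s : seq I)
    (F : I -> set X) (U : set X) : (forall t, closed (F t)) ->
  open U -> U !=set0 -> U `<=` [set x | exists2 t, t \in s & F t x] ->
  exists t x, U x /\ interior (F t) x.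
Proof.
move=> cF; elim: s U => [|t s IH] U oU [x Ux] Us.
  by have [] := Us x Ux.
(* Either [U] lies in the first set, or removing this closed set leaves a non-empty open set covered
   by the remaining ones. *)
have [UF|/existsNP[y /not_implyP[Uy Fy]]] := pselect (U `<=` F t).
  by exists t, x; split => //; apply: filterS UF _; exact: open_nbhs_nbhs.
have [|||t' [z [[Uz _] Fz]]] := IH (U `&` ~` F t).
- by apply: openI => //; exact: closed_openC.
- by exists y.
- move=> z [Uz Fz]; have [t'] := Us z Uz.
  by rewrite inE => /predU1P[->//|t's Ft']; exists t'.
- by exists t', z.
Qed.

Lemma eq_on_open_derive (R : realType) (V : normedModType R) (U : set V)
    (f g : V -> R) (v : V) : open U -> (forall x, U x -> f x = g x) ->
  forall x, U x -> 'D_v f x = 'D_v g x.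
Proof.
move=> oU fg x Ux; apply: near_eq_derive.
have : nbhs x U by exact: open_nbhs_nbhs.
by apply: filterS => y; exact: fg.
Qed.

(** By contradiction: a value above the bound at one point persists, by continuity, on an open set.
    That set meets the interior of a simplex, where the spline is a polynomial obeying the bound. *)
Lemma spline_hess_bounded (R : realType) d (Omega : set 'rV[R]_d) N
    (T : 'I_N -> simplex_vertices R d) r D (c : 'cV[R]_(ncoef d N D)) s :
  bounded_set Omega -> triangulation Omega T -> is_spline Omega T r c s ->
  (forall i j x, Omega x -> {for x, continuous
    (fun y => 'D_(unitv R i) (fun z => 'D_(unitv R j) s z) y)}) ->
  exists M, forall i j x, Omega x ->
    `|'D_(unitv R i) (fun z => 'D_(unitv R j) s z) x| <= M.
Proof.
move=> bO [_ OT _] [_ sp] cs.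
have oO : open Omega by rewrite OT; exact: open_interior.
have [B _ OB] := bounded_set_box _ _ _ bO.
pose hp (p : 'I_N * ('I_d * 'I_d)) x :=
  'D_(unitv R p.2.1) (fun z => 'D_(unitv R p.2.2) (piece T c p.1) z) x.
have /choice[K hK] : forall p, exists K, forall x, box B x -> `|hp p x| <= K.
  move=> p; apply: polyfun_bounded; apply: (polyfun_derive _ _ _).2.
  by apply: (polyfun_derive _ _ _).2; exact: polyfun_piece.
exists (\sum_p `|K p|) => i j x Ox; rewrite leNgt; apply/negP => Mx.
pose h y := 'D_(unitv R i) (fun z => 'D_(unitv R j) s z) y.
pose U := interior (Omega `&` [set y | \sum_p `|K p| < `|h y|]).
have Ux : U x.
  apply: filterI; first exact: open_nbhs_nbhs.
  have cn : {for x, continuous (fun y => `|h y|)}.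
    by apply: continuous_comp; [exact: cs|exact: norm_continuous].
  exact: (cvgr_gt _ cn).
have [t [y [/interior_subset[Oy /= My] ty]]] :
    exists t y, U y /\ interior (simplex (T t)) y.
  apply: (@closed_cover_interior _ _ (enum 'I_N)).
  - by move=> t; exact: closed_simplex.
  - exact: open_interior.
  - by exists x.
  - move=> y /interior_subset[Oy _]; move: Oy; rewrite OT => /interior_subset[t _ ty].
    by exists t; rewrite ?mem_enum.
have oI : open (interior (simplex (T t))) by exact: open_interior.
move: My; rewrite /h (eq_on_open_derive _ _ _ _
  (fun z => 'D_(unitv R j) (piece T c t) z) _ oI _ _ ty).
  apply/negP; rewrite -leNgt (le_trans (hK (t, (i, j)) y (OB y Oy)))//.
  by rewrite (le_trans (ler_norm _))// (bigD1 (t, (i, j)))//= lerDl sumr_ge0.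
by apply: eq_on_open_derive => // z; exact: sp.
Qed.

(** * H^2 regularity of the error *)

Section regularity.
Context {R : realType} {n : nat} {Omega : set 'rV[R]_n}.
Hypotheses (oO : open Omega) (bO : bounded_set Omega).
Implicit Types f g phi s : 'rV[R]_n -> R.
Local Notation mu := (lebesgue_rV R n).

Let mO : measurable Omega. Proof. exact: open_measurable_rV. Qed.

Lemma bounded_lebesgue_lty : (mu Omega < +oo)%E.
Proof.
have [B _ OB] := bounded_set_box _ _ _ bO.
apply: le_lt_trans (lebesgue_box_lty R n B); apply: le_measure => //; rewrite inE//.
exact: measurable_box.
Qed.

Lemma bounded_in_L2 f M : measurable_fun Omega f ->
  (forall x, Omega x -> `|f x| <= M) -> in_Lp Omega 2%:E f.
Proof.
move=> mf fM; split => //.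
exact: (L2norm_bounded mO f M bounded_lebesgue_lty mf fM).
Qed.

Lemma in_L2B f g : in_Lp Omega 2%:E f -> in_Lp Omega 2%:E g ->
  in_Lp Omega 2%:E (fun x => f x - g x).
Proof.
move=> [mf f2] [mg g2]; have mNg : measurable_fun Omega (fun x => - g x).
  exact: measurableT_comp.
split; first exact: measurable_funD.
apply: (le_lt_trans (L2normD_le mO f (fun x => - g x) mf mNg)).
rewrite lte_add_pinfty// (L2norm_ae_eq mO _ g)//.
by apply/nearW => x _; rewrite normrN.
Qed.

(** Cauchy-Schwarz on the whole space, for the extensions by zero. *)
Lemma integrable_mul_L2 f g : in_Lp Omega 2%:E f -> in_Lp Omega 2%:E g ->
  mu.-integrable Omega (EFin \o (f \* g)).
Proof.
have Lf h : in_Lp Omega 2%:E h -> h \_ Omega \in Lfun mu 2%:E.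
  move=> [mh h2]; rewrite inE; apply/andP; split; rewrite inE//=.
  exact: (measurable_restrictT _ mO).1.
move=> /Lf f2 /Lf g2.
have /Lfun1_integrable := Lfun2_mul_Lfun1 f2 g2.
rewrite (_ : _ \o _ = (EFin \o (f \* g)) \_ Omega); first by move/(integrable_mkcond _ mO).
by apply/funext => x; rewrite /= !patchE; case: ifPn => // _; rewrite mulr0.
Qed.

(** Only second derivatives are at stake, H^1 membership of the difference being assumed. Those of
    [s] are in L^2, being bounded on a set of finite measure, and the weak identities for [u] and
    [s] are subtracted. *)
Lemma in_H2_sub u s M : in_H2 Omega u ->
  Ck Omega 2 s ->
  (forall i j x, Omega x ->
    `|'D_(unitv R i) (fun z => 'D_(unitv R j) s z) x| <= M) ->
  in_H1 Omega (jet_sub u (classical_jet s)) ->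
  in_H2 Omega (jet_sub u (classical_jet s)).
Proof.
move=> [[u0 u1] u2] [cs ds] hM us1; split => // i j.
have [u2L u2W] := u2 i j; have [_ us1'] := us1.
have [usj _] := us1' j.
have [dsj [cDs dDs]] := ds j; have [ddsj [cDDs _]] := dDs i.
have mDD : measurable_fun Omega (jhess (classical_jet s) i j).
  exact: (continuous_on_measurable _ _ _ _ oO cDDs).
have DDL : in_Lp Omega 2%:E (jhess (classical_jet s) i j).
  by apply: (bounded_in_L2 _ M) => // x Ox; exact: hM.
split; first exact: in_L2B.
move=> phi tphi.
have [K [cK clK KO phi0 dphi0]] := test_function_support tphi.
have [cphi cdphi dphi] := test_function_continuous tphi.
have testL f : (forall x, ~ K x -> f x = 0) -> continuous f -> in_Lp Omega 2%:E f.
  move=> f0 cf; have [N fN] := compact_support_bounded K f cK f0 cf.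
  apply: (bounded_in_L2 _ N) => //.
  by apply: continuous_on_measurable => // x _; exact: cf.
have phiL := testL phi phi0 cphi.
have dphiL := testL _ (dphi0 i) (cdphi i).
have usW : weak_partial Omega i (jgrad (classical_jet s) j)
    (jhess (classical_jet s) i j).
  exact: weak_partial_C1.
have [uj _] := u1 j.
(* The gradient of [s] has not been bounded; its L^2 membership is recovered by subtracting the
   gradient of u - s from that of [u]. *)
have sj : in_Lp Omega 2%:E (jgrad (classical_jet s) j).
  have := in_L2B _ _ uj usj; rewrite /jet_sub /=.
  by under eq_fun do rewrite opprB addrC subrK.
(* These make the four integrals finite, so that they may be split and subtracted in the extended
   reals. *)
have i1 := integrable_mul_L2 _ _ uj dphiL.
have i2 := integrable_mul_L2 _ _ sj dphiL.
have i3 := integrable_mul_L2 _ _ u2L phiL.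
have i4 := integrable_mul_L2 _ _ DDL phiL.
have intB f g h : mu.-integrable Omega (EFin \o (f \* h)) ->
    mu.-integrable Omega (EFin \o (g \* h)) ->
    (\int[mu]_(x in Omega) ((f x - g x) * h x)%:E =
     \int[mu]_(x in Omega) (f x * h x)%:E -
     \int[mu]_(x in Omega) (g x * h x)%:E)%E.
  move=> fi gi; rewrite -[RHS](integralB mO fi gi).
  by apply: eq_integral => x _; rewrite /= mulrBl.
rewrite /jet_sub /= [LHS](intB _ _ _ i1 i2) [X in _ = (- X)%E](intB _ _ _ i3 i4).
have /= W1 := u2W phi tphi; have /= W2 := usW phi tphi.
have fin4 := integrable_fin_num mO i4.
by rewrite [X in (X - _)%E]W1 [X in (_ - X)%E]W2 (fin_num_oppeB _ fin4) oppeK.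
Qed.

End regularity.

(** * The error estimate *)

Lemma Ck_le (R : realType) n (Omega : set 'rV[R]_n) k l f :
  (l <= k)%N -> Ck Omega k f -> Ck Omega l f.
Proof.
elim: l k f => [|l IH] [|k] f //=; first by move=> _ [].
rewrite ltnS => lk [cf df]; split => // i; have [di Ci] := df i.
by split => //; exact: IH Ci.
Qed.

Lemma Lop_sub (R : realType) n (a : coefficients R n) (u v : jet R n) x :
  Lop a (jet_sub u v) x = Lop a u x - Lop a v x.
Proof.
rewrite /Lop -sumrB; apply: eq_bigr => i _; rewrite -sumrB.
by apply: eq_bigr => j _; rewrite -mulrBr.
Qed.

(** The order of quantifiers records the dependence of [C]: it is a function of [A1] fixed once
    [Omega] is known, before the operator, the data and the spline. The existence of some positive
    [A1] is asserted as well, so that the estimate does not range over an empty set of constants. *)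
Theorem theorem9 (R : realType) (d : nat) (Omega : set 'rV[R]_d) :
  (2 <= d)%N ->
  open Omega -> connected Omega -> Omega !=set0 -> bounded_set Omega ->
  polygonal Omega -> uniformly_positive_reach (closure Omega) ->
  exists C : R -> R, (forall A1, 0 < A1 -> 0 < C A1) /\
  forall (a : coefficients R d) (lam Lam eps A : R),
    (forall i j, in_Lp Omega +oo%E (a i j)) ->
    (forall i j x, Omega x -> a i j x = a j i x) ->
    0 < lam -> lam <= Lam -> elliptic Omega a lam Lam ->
    0 < eps -> eps <= 1 -> cordes Omega a eps ->
    0 < A -> H2_coercive Omega (@laplacian R d) A -> 1 - A ^+ 2 < eps ->
    (exists2 A1 : R, 0 < A1 & H2_coercive Omega (Lop a) A1) /\
    forall A1 : R, 0 < A1 -> H2_coercive Omega (Lop a) A1 ->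
    forall (f g : 'rV[R]_d -> R) (u : jet R d)
      (N : nat) (T : 'I_N -> simplex_vertices R d) (r D D' : nat)
      (mH m0 : nat) (H : 'M[R]_(mH, ncoef d N D)) (H0 : 'M[R]_(m0, ncoef d N D))
      (alpha beta gam eps1 : R) (c : 'cV[R]_(ncoef d N D)) (us : 'rV[R]_d -> R),
    (* u solves L u = f in Omega, u = g on the boundary *)
    in_Lp Omega 2%:E f ->
    in_H3 Omega u ->
    {ae lebesgue_rV R d, forall x, Omega x -> Lop a u x = f x} ->
    boundary_value Omega u g ->
    (* us is the spline collocation minimizer *)
    triangulation Omega T ->
    (2 <= r)%N ->
    (d = 2%N -> (3 * r + 2 <= D)%N) -> (d = 3%N -> (6 * r + 3 <= D)%N) ->
    (D < D')%N ->
    (forall c', H *m c' = 0 <-> smooth_across T r c') ->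
    (forall c', H0 *m c' = 0 <-> smooth_across T 0 c') ->
    0 < alpha -> 0 < beta -> 0 < gam ->
    is_spline Omega T r c us ->
    collocation_minimizer Omega a f g T D' alpha beta gam H H0 c eps1 ->
    (L2norm Omega (fun x => Lop a (classical_jet us) x - f x)%R
       <= eps1%:E)%E ->
    (* u - us = 0 on the boundary *)
    in_H10 Omega (jet_sub u (classical_jet us)) ->
    [/\ (L2norm Omega (jfun (jet_sub u (classical_jet us)))
           <= (C A1 * eps1)%:E)%E,
        (grad_L2norm Omega (jet_sub u (classical_jet us))
           <= (C A1 * eps1)%:E)%E &
        (H2seminorm Omega (jet_sub u (classical_jet us))
           <= (C A1 * eps1)%:E)%E].
Proof.
move=> d2 oO _ _ bO _ _; exists (fun A1 => A1^-1); split.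
  by move=> A1; rewrite invr_gt0.
have d0 : (0 < d)%N by exact: leq_trans d2.
have mO := open_measurable_rV _ _ _ oO.
move=> a lam Lam eps A aL _ lam0 _ ell eps0 _ cor A0 lapA Aeps.
have ma i j : measurable_fun Omega (a i j) by have [] := aL i j.
split.
  (* The constant of [cordes_coercive]; it is positive because eps > 1 - A^2 gives sqrt (1 - eps) <
     A. *)
  exists (lam * (A - Num.sqrt (1 - eps))).
    rewrite mulr_gt0// subr_gt0 -(gtr0_norm A0) -sqrtr_sqr ltr_sqrt ?exprn_gt0//.
    by move: Aeps; lra.
  exact: (cordes_coercive _ _ _ _ _ Lam).
move=> A1 A10 LA f g u N T r D D' mH m0 H H0 alpha beta gam eps1 c us.
move=> [mf _] [uH2 _] Lu _ triT r2 _ _ _ _ _ _ _ _ spl _ Lus us10.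
have Ck2 : Ck Omega 2 us.
  exact: Ck_le r2 spl.1.
set v := jet_sub u (classical_jet us).
have [_ dus] := Ck2.
(* The smoothness order r >= 2 supplies the continuity of second derivatives inside [Omega] on which
   this bound rests. *)
have [M hM] := spline_hess_bounded _ _ _ _ _ _ _ _ _ bO triT spl
  (fun i j x Ox => ((dus j).2.2 i).2.1 x Ox).
have vH2 : in_H2 Omega v.
  by apply: (in_H2_sub oO bO _ _ M) => //; exact: us10.1.
(* Almost everywhere L v = f - L us, the residual up to sign. *)
have Lv : L2norm Omega (Lop a v) =
    L2norm Omega (fun x => Lop a (classical_jet us) x - f x).
  have mDD i j : measurable_fun Omega (jhess (classical_jet us) i j).
    exact: (continuous_on_measurable _ _ _ _ oO ((dus j).2.2 i).2.1).
  apply: (L2norm_ae_eq mO).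
  - by apply: measurable_Lop => // i j; have [[]] := vH2.2 i j.
  - by apply: measurable_funB => //; exact: measurable_Lop.
  - by apply: filterS Lu => x Lux Ox; rewrite Lop_sub Lux// distrC.
have : (H2norm Omega v <= (A1^-1 * eps1)%:E)%E.
  have := LA v vH2 us10; rewrite Lv => /le_trans /(_ Lus).
  rewrite EFinM.
  by rewrite lee_pdivlMl.
rewrite /H2norm => Hv.
have n0 := @L2norm_ge0 R d Omega.
have sn0 : (0 <= H2seminorm Omega v)%E.
  by apply: sume_ge0 => i _; apply: sume_ge0 => j _; exact: n0.
have gn0 : (0 <= grad_L2norm Omega v)%E by exact: n0.
(* Each of the three non-negative terms is at most their sum, the H^2 norm. *)
split; apply: le_trans Hv.
- by rewrite -addeA leeDl// adde_ge0.
- by rewrite -addeA addeCA leeDl// adde_ge0.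
- by rewrite leeDr// adde_ge0.
Qed.
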